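(* There are universal constants $C_0>0$ and $\gamma>1$ such that the following holds. Let $\Psi=(\psi_1,\dots,\psi_N)\in\mathbb{C}^{N\times N}$ be an orthonormal basis, let $\bar w\in\mathbb{R}$ be a discrete chirp rate, let $N_w=(1+|\bar w|)N$, let $U\in\mathbb{C}^{N_w\times N}$ be the up-sampling operator, let $C\in\mathbb{C}^{N_w\times N_w}$ be the diagonal chirp-modulation matrix, and let $F=(f_1,\dots,f_{N_w})\in\mathbb{C}^{N_w\times N_w}$ be the discrete Fourier basis. Put $$A^{w}=F^*CU\Psi\in\mathbb{C}^{N_w\times N},\qquad \mu_w=\max_{1\leq i\leq N_w,\;1\leq j\leq N}\left|\langle f_i, CU\psi_j\rangle\right|.$$ Let $\alpha\in\mathbb{C}^N$ be an $s$-sparse vector, let $\Omega=\{l_1,\dots,l_m\}$ consist of $m$ indices chosen independently and uniformly at random from $\{1,\dots,N_w\}$, and let $y=A^{w}_\Omega\,\alpha\in\mathbb{C}^m$. If $$m\geq C_0\,N_w\,\mu_w^2\, s\,\log^4(N),$$ then, with probability at least $1-N^{-\gamma\log^3(N)}$, $\alpha$ is the unique minimizer of the $\ell_1$-minimization problem $$\min_{\alpha'\in\mathbb{C}^N}\|\alpha'\|_1\quad\text{subject to}\quad y=A^{w}_\Omega\,\alpha'.$$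
   Context: An orthonormal basis is identified with the unitary matrix whose columns are the basis vectors. $\cdot^*$ denotes the conjugate transpose, $\langle f,g\rangle=f^*g$, $\|\alpha\|_1=\sum_{i=1}^N|\alpha_i|$, and $\log$ is the natural logarithm. A vector is $s$-sparse ($s\geq1$) if it has at most $s$ non-zero entries. For a matrix $A$ with $N_w$ rows, $A_\Omega$ is the matrix with $m$ rows whose $r$-th row is the $l_r$-th row of $A$, $r=1,\dots,m$ (indices may be repeated). Setting. A signal on a field of view of size $L$ is discretized on a regular grid of $N$ points. The linear chirp with chirp rate $w\in\mathbb{R}$ is the function $c(\tau)=e^{\mathrm{i}\pi w\tau^2}$ of the spatial variable $\tau$ (with $\tau^2=|\tau|^2$ if $\tau\in\mathbb{R}^2$), so $|c(\tau)|=1$; its discrete chirp rate is $\bar w=wL^2/N$. The up-sampled grid is a regular grid of $N_w=(1+|\bar w|)N$ points (assumed to be an integer) on the same field of view. - $F\in\mathbb{C}^{N_w\times N_w}$ is the (unitary) discrete Fourier basis on the up-sampled grid. - $U\in\mathbb{C}^{N_w\times N}$ is the up-sampling operator implemented by zero padding in Fourier space: $U=F P F_N^*$, where $F_N\in\mathbb{C}^{N\times N}$ is the unitary discrete Fourier basis on the original grid and $P\in\{0,1\}^{N_w\times N}$ places the $N$ Fourier coefficients at the corresponding frequencies among the $N_w$ frequencies of the up-sampled grid and puts zeros elsewhere. It satisfies $U^*U=I\in\mathbb{C}^{N\times N}$. - $C\in\mathbb{C}^{N_w\times N_w}$ is the diagonal matrix whose diagonal entries are the values $c(\tau_k)$ of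 the chirp at the points $\tau_1,\dots,\tau_{N_w}$ of the up-sampled grid. *)

(* Defs.v *)
(* MathComp / MathComp-Analysis; the complex numbers are R[i] over R : realType. *)
From HB Require Import structures.
From mathcomp Require Import all_boot all_order all_algebra.
From mathcomp Require Import complex.
From mathcomp Require Import all_classical all_reals all_analysis.

Set Implicit Arguments.
Unset Strict Implicit.
Unset Printing Implicit Defensive.

Import Order.TTheory GRing.Theory Num.Theory.
Local Open Scope ring_scope.
Local Open Scope complex_scope.
Local Open Scope sesquilinear_scope.

Section Vectors.
Variable R : realType.

Definition cabs (z : R[i]) : R := ComplexField.Normc.normc z.

Definition inner q (f g : 'cV[R[i]]_q) : R[i] := (f^t* *m g) ord0 ord0.

Definition l1norm q (a : 'cV[R[i]]_q) : R := \sum_(i < q) cabs (a i ord0).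

Definition sparse q (s : nat) (a : 'cV[R[i]]_q) : Prop :=
  (#|[pred i : 'I_q | (a i ord0 != 0)%R]| <= s)%N.

Definition is_l1_minimizer m q (B : 'M[R[i]]_(m, q)) (y : 'cV[R[i]]_m)
    (a : 'cV[R[i]]_q) : Prop :=
  y = B *m a /\
  forall a' : 'cV[R[i]]_q, y = B *m a' -> l1norm a <= l1norm a'.

Definition is_unique_l1_minimizer m q (B : 'M[R[i]]_(m, q)) (y : 'cV[R[i]]_m)
    (a : 'cV[R[i]]_q) : Prop :=
  is_l1_minimizer B y a /\
  forall a' : 'cV[R[i]]_q, is_l1_minimizer B y a' -> a' = a.

(* Probability of E when l_0, ..., l_{m-1} are independent and uniform on
   'I_q: the m-fold product of the uniform law (repetitions allowed). *)
Definition iid_uniform_prob m q (E : {ffun 'I_m -> 'I_q} -> Prop) : R :=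
  \sum_(l : {ffun 'I_m -> 'I_q} | `[< E l >]) \prod_(r < m) (q%:R)^-1.

(* The rows of A indexed by l, in order and with repetitions. *)
Definition sample_rows m p q (l : {ffun 'I_m -> 'I_p}) (A : 'M[R[i]]_(p, q)) :
  'M[R[i]]_(m, q) := mxsub l id A.

End Vectors.

(* A regular grid with n points on each of the D axes has N = n ^ D points;
   point (or frequency) number k < N has multi-index the base-n digits of k.
   For D = 1 this is k itself. *)
Definition grid_coord (n k d : nat) : nat := ((k %/ n ^ d) %% n)%N.

(* The signed frequency, in [-n/2, n/2), represented by the discrete Fourier
   index f < n. *)
Definition signed_freq (n f : nat) : int :=
  if (f.*2 < n)%N then f%:Z else f%:Z - n%:Z.

Section Operators.
Variable R : realType.

Definition expi (t : R) : R[i] := cos t +i* sin t.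

(* The basis vectors are the columns, so the analysis map is (dft D n N)^t*. *)
Definition dft (D n N : nat) : 'M[R[i]]_N :=
  \matrix_(i < N, j < N)
    ((Num.sqrt N%:R)^-1%:C *
     expi (2 * pi * ((\sum_(d < D) grid_coord n i d * grid_coord n j d)%N)%:R / n%:R)).

Definition zero_padding (D n nw N Nw : nat) : 'M[R[i]]_(Nw, N) :=
  \matrix_(i < Nw, j < N)
    ([forall d : 'I_D,
        signed_freq nw (grid_coord nw i d) == signed_freq n (grid_coord n j d)])%:R.

Definition upsampling (D n nw N Nw : nat) : 'M[R[i]]_(Nw, N) :=
  dft D nw Nw *m zero_padding D n nw N Nw *m (dft D n N)^t*.

(* The field of view is x0 + [0, L]^D.  The corner x0 is a parameter, so that
   no convention is imposed on where the chirp is centered. *)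
Definition grid_point (D n : nat) (L : R) (x0 : 'rV[R]_D) (k : nat) :
  'rV[R]_D := \row_(d < D) (x0 ord0 d + (grid_coord n k d)%:R * L / n%:R).

Definition chirp (D : nat) (w : R) (tau : 'rV[R]_D) : R[i] :=
  expi (pi * w * \sum_(d < D) (tau ord0 d) ^+ 2).

Definition chirp_mx (D nw Nw : nat) (w L : R) (x0 : 'rV[R]_D) : 'M[R[i]]_Nw :=
  diag_mx (\row_(k < Nw) chirp w (grid_point nw L x0 k)).

Definition discrete_chirp_rate (w L : R) (N : nat) : R := w * L ^+ 2 / N%:R.

(* max_{i,j} |<f_i, M psi_j>|, f_i and psi_j being the columns of F and Psi;
   the default value 0 of the maximum is neutral, moduli being nonnegative. *)
Definition coherence (p q : nat) (F : 'M[R[i]]_p) (M : 'M[R[i]]_(p, q))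
    (Psi : 'M[R[i]]_q) : R :=
  \big[Num.max/0]_(i < p) \big[Num.max/0]_(j < q)
     cabs (inner (col i F) (M *m col j Psi)).

End Operators.

(* Main.v *)
(* Golfing (after Gross and Candes-Plan) with independent batches.  Since
   A^* A = 1 and |A_ij| <= mu, a batch of b ~ N_w mu^2 s log N samples satisfies
   |(N_w/b) A_batch^* A_batch v - v|_infinity <= |v|_2 / (8 sqrt s) for a fixed
   v supported on S = supp alpha, except with probability 4 N^-7: a scalar
   Bernstein bound for each coordinate.  Such a batch shrinks the residual of an
   inexact dual certificate by 1/8 on S, and changes it off S by at most
   |v|_2 / (8 sqrt s); other batches are discarded.  Among 2k ~ log^3 N batches
   at least k succeed, except with probability N^(-3k), which is where the
   exponent log^4 N of the failure probability comes from.  Certificates are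
   built for the sign vector of alpha and also for each basis vector e_k with
   k in S: the latter bound |h_S|_2 by |h_{S^c}|_1 for h in the kernel, so that
   no estimate of the conditioning of A_{Omega,S} is needed. *)
Require Import Defs.
From HB Require Import structures.
From mathcomp Require Import all_boot all_order all_algebra.
From mathcomp Require Import complex ring lra zify.
From mathcomp Require Import all_classical all_reals all_analysis.

Set Implicit Arguments.
Unset Strict Implicit.
Unset Printing Implicit Defensive.

Import Order.TTheory GRing.Theory Num.Theory.
Local Open Scope ring_scope.
Local Open Scope complex_scope.
Local Open Scope sesquilinear_scope.

(** * Averages over independent uniform samples *)

Section Average.
Context {R : realType} {T : finType}.
Implicit Types F G : seq T -> R.

(* Expectation of F over n independent uniform samples. *)
Fixpoint avg (n : nat) F : R :=
  if n is n'.+1 then (\sum_(x : T) avg n' (fun xs => F (x :: xs))) / #|T|%:R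
  else F [::].

Lemma avg_cat n m F :
  avg (n + m) F = avg n (fun xs => avg m (fun ys => F (xs ++ ys))).
Proof.
elim: n F => [|n IH] F //=; congr (_ / _).
by apply: eq_bigr => x _; rewrite IH.
Qed.

Lemma le_avg n F G :
  (forall xs, size xs = n -> F xs <= G xs) -> avg n F <= avg n G.
Proof.
elim: n F G => [|n IH] F G le_FG /=; first exact: le_FG.
rewrite ler_wpM2r ?invr_ge0 //; apply: ler_sum => x _.
by apply: IH => xs size_xs; apply: le_FG; rewrite /= size_xs.
Qed.

Lemma eq_avg n F G :
  (forall xs, size xs = n -> F xs = G xs) -> avg n F = avg n G.
Proof.
by move=> eq_FG; apply/eqP; rewrite eq_le !le_avg // => xs /eq_FG ->.
Qed.

Lemma avgZ n c F : avg n (fun xs => c * F xs) = c * avg n F.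
Proof.
elim: n F => [|n IH] F //=; rewrite mulrA mulr_sumr; congr (_ / _).
by apply: eq_bigr => x _; rewrite IH.
Qed.

Lemma avgD n F G : avg n (fun xs => F xs + G xs) = avg n F + avg n G.
Proof.
elim: n F G => [|n IH] F G //=; rewrite -mulrDl -big_split /=; congr (_ / _).
by apply: eq_bigr => x _; rewrite IH.
Qed.

Lemma avg_sum n (I : Type) (r : seq I) (D : pred I) (F : I -> seq T -> R) :
  avg n (fun xs => \sum_(i <- r | D i) F i xs) =
  \sum_(i <- r | D i) avg n (F i).
Proof.
elim: n F => [|n IH] F //=; rewrite -mulr_suml exchange_big /=; congr (_ / _).
by apply: eq_bigr => x _; rewrite IH.
Qed.

Lemma avg_prod n (f : T -> R) :
  avg n (fun xs => \prod_(x <- xs) f x) = ((\sum_x f x) / #|T|%:R) ^+ n.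
Proof.
elim: n => [|n IH]; first by rewrite /= big_nil expr0.
rewrite exprS -IH /= mulrAC; congr (_ / _); rewrite mulr_suml.
apply: eq_bigr => x _; rewrite -avgZ; apply: eq_avg => xs _.
by rewrite big_cons.
Qed.

Lemma avg_cst n (c : R) : (0 < #|T|)%N -> avg n (fun=> c) = c.
Proof.
move=> T_gt0; elim: n => //= n ->.
by rewrite sumr_const -[c *+ _]mulr_natr mulfK // pnatr_eq0 -lt0n.
Qed.

(** Links sequences, along which golfing recurses, with the product law behind [iid_uniform_prob].
    The induction splits a function into its value at [ord0] and the rest. *)
Lemma avg_finfun n F :
  avg n F = \sum_(l : {ffun 'I_n -> T}) F (codom l) * \prod_(r < n) (#|T|%:R)^-1.
Proof.
elim: n F => [|n IH] F.
  rewrite (eq_bigr (fun=> F [::])) => [|l _].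
    by rewrite sumr_const card_ffun card_ord expn0 mulr1n.
  by rewrite big_ord0 mulr1 codomE enum_ord0.
pose h (xl : T * {ffun 'I_n -> T}) : {ffun 'I_n.+1 -> T} :=
  [ffun i => if unlift ord0 i is Some j then xl.2 j else xl.1].
pose h' (l : {ffun 'I_n.+1 -> T}) := (l ord0, [ffun j => l (lift ord0 j)]).
have hK : cancel h h'.
  case=> x l; rewrite /h' /h /= ffunE unlift_none; congr pair.
  by apply/ffunP => j; rewrite !ffunE liftK.
have h'K : cancel h' h.
  move=> l; apply/ffunP => i; rewrite ffunE.
  by case: unliftP => [j|] -> //=; rewrite ffunE.
rewrite (reindex h) /=; last by exists h' => ? _; [exact: hK|exact: h'K].
rewrite mulr_suml.
rewrite (eq_bigr (fun x => \sum_(l : {ffun 'I_n -> T})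
   F (codom (h (x, l))) * \prod_(r < n.+1) (#|T|%:R)^-1)); last first.
  move=> x _; rewrite IH mulr_suml; apply: eq_bigr => l _.
  rewrite big_ord_recl mulrA -mulrA [_ / _]mulrC mulrA; congr (F _ * _ * _).
  rewrite !codomE enum_ordSl /= ffunE unlift_none -map_comp; congr cons.
  by apply: eq_map => j; rewrite /= ffunE liftK.
by rewrite pair_bigA; apply: eq_bigr => -[].
Qed.

(** * Exponential moments and Bernstein's inequality *)

Lemma expR_le_quadratic (y : R) : y <= 1 / 2 -> expR y <= 1 + y + 2 * y ^+ 2.
Proof.
move=> y_le; have y_lt1 : 0 < 1 - y by lra.
apply: (@le_trans _ _ (1 - y)^-1).
  rewrite -[y in expR y]opprK expRN lef_pV2 ?posrE ?expR_gt0 //.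
  by have := expR_ge1Dx (- y); lra.
rewrite -[leLHS]mul1r ler_pdivrMr //; nra.
Qed.

(** Chernoff's method: independence factors the exponential moment of the sum. [V] bounds the raw
    second moment, and [theta] is left for the caller to optimize. *)
Lemma bernstein (Z : T -> R) (n : nat) (mean V theta tau : R) :
  (0 < #|T|)%N -> 0 <= theta ->
  (forall x, theta * Z x <= 1 / 2) ->
  (\sum_x Z x) / #|T|%:R = mean ->
  (\sum_x Z x ^+ 2) / #|T|%:R <= V ->
  avg n (fun xs => (n%:R * (mean + tau) < \sum_(x <- xs) Z x)%R%:R) <=
  expR (n%:R * (2 * theta ^+ 2 * V - theta * tau)).
Proof.
move=> T_gt0 theta_ge0 Z_le meanE V_ge.
have cT : 0 < #|T|%:R :> R by rewrite ltr0n.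
set a := n%:R * (mean + tau).
(* Markov's inequality: the indicator is at most the exponential of [theta] times the excess over
   [a]. *)
apply: (@le_trans _ _ (expR (- (theta * a)) *
    avg n (fun xs => \prod_(x <- xs) expR (theta * Z x)))).
  rewrite -avgZ; apply: le_avg => xs _.
  rewrite -expR_sum -expRD -mulr_sumr.
  case: ltP => [lt_a|_]; last exact: expR_ge0.
  by apply: le_trans (expR_ge1Dx _); rewrite lerDl; nra.
rewrite avg_prod.
have mgf : (\sum_x expR (theta * Z x)) / #|T|%:R <=
    expR (theta * mean + 2 * theta ^+ 2 * V).
  apply: le_trans (expR_ge1Dx _); apply: (@le_trans _ _
    ((\sum_x (1 + theta * Z x + 2 * theta ^+ 2 * Z x ^+ 2)) / #|T|%:R)).
    rewrite ler_pM2r ?invr_gt0 //; apply: ler_sum => x _.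
    by apply: le_trans (expR_le_quadratic (Z_le x)) _; rewrite exprMn mulrA.
  rewrite !big_split /= sumr_const -!mulr_sumr.
  rewrite !(mulrDl _ _ (_^-1)) divff ?gt_eqF //.
  rewrite -addrA -(mulrA theta) meanE -(mulrA (2 * _)) lerD2l lerD2l.
  by apply: ler_wpM2l V_ge; rewrite mulr_ge0 ?sqr_ge0.
apply: le_trans (ler_wpM2l (expR_ge0 _) (lerXn2r n _ _ mgf)) _.
- by rewrite nnegrE divr_ge0 // sumr_ge0 // => x _; apply: expR_ge0.
- by rewrite nnegrE expR_ge0.
rewrite -expRM_natl -expRD ler_expR /a; lra.
Qed.

End Average.

(** * Complex vectors *)

Section ComplexVectors.
Context {R : realType}.
Implicit Types z u : R[i].

Lemma cabsE z : `|z| = (cabs z)%:C.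
Proof. by case: z. Qed.

Lemma cabs_ge0 z : 0 <= cabs z.
Proof. by rewrite -ler0c -cabsE. Qed.

Lemma cabsM z u : cabs (z * u) = cabs z * cabs u.
Proof. exact: ComplexField.Normc.normcM. Qed.

Lemma le_cabsD z u : cabs (z + u) <= cabs z + cabs u.
Proof. exact: le_normcD. Qed.

Lemma cabs0 : cabs (0 : R[i]) = 0.
Proof. exact: ComplexField.Normc.normc0. Qed.

Lemma cabs_eq0 z : (cabs z == 0) = (z == 0).
Proof.
by apply/eqP/eqP => [/ComplexField.Normc.eq0_normc|->]; last exact: cabs0.
Qed.

Lemma cabsN z : cabs (- z) = cabs z.
Proof. exact: normcN. Qed.

Lemma cabs_real (x : R) : 0 <= x -> cabs x%:C = x.
Proof. by move=> x_ge0; rewrite /cabs /= expr0n addr0 sqrtr_sqr ger0_norm. Qed.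

Lemma cabs_conj z : cabs (Num.conj z) = cabs z.
Proof. by apply/complexI; rewrite -!cabsE norm_conjC. Qed.

Lemma conjM z u : Num.conj (z * u) = Num.conj z * Num.conj u.
Proof. exact: rmorphM. Qed.

Lemma conj_real (x : R) : Num.conj x%:C = x%:C.
Proof. exact: conjc_real. Qed.

Lemma le_cabs_sum (I : Type) (r : seq I) (P : pred I) (F : I -> R[i]) :
  cabs (\sum_(i <- r | P i) F i) <= \sum_(i <- r | P i) cabs (F i).
Proof.
elim/big_ind2: _ => [|x a y b le_x le_y|i _]; rewrite ?cabs0 //.
by apply: le_trans (le_cabsD _ _) _; apply: lerD.
Qed.

Lemma ReD z u : complex.Re (z + u) = complex.Re z + complex.Re u.
Proof. by case: z; case: u. Qed.

Lemma Re_sum (I : Type) (r : seq I) (P : pred I) (F : I -> R[i]) :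
  complex.Re (\sum_(i <- r | P i) F i) = \sum_(i <- r | P i) complex.Re (F i).
Proof. exact: (big_morph _ ReD). Qed.

Lemma Re_le_cabs z : complex.Re z <= cabs z.
Proof.
by rewrite -lecR -cabsE; apply: le_trans (normc_ge_Re z); rewrite lecR ler_norm.
Qed.

Lemma cabs_sqr z : cabs z ^+ 2 = complex.Re z ^+ 2 + complex.Im z ^+ 2.
Proof. by case: z => a b; rewrite /cabs /= sqr_sqrtr // addr_ge0 ?sqr_ge0. Qed.

Lemma mul_conj_cabs z : Num.conj z * z = (cabs z ^+ 2)%:C.
Proof. by rewrite mulrC -normCK cabsE -rmorphXn. Qed.

(** Testing real parts in four directions lets the real-valued [bernstein] control a complex
    modulus, at the cost of a factor 2 in [cabs_le_directions]. *)
Definition directions : seq R[i] := [:: 1; -1; 'i; - 'i].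

Lemma cabs_directions u : u \in directions -> cabs u = 1.
Proof.
rewrite /directions !inE => /or4P[] /eqP ->;
  by rewrite ?cabsN /cabs /= ?expr0n ?expr1n ?addr0 ?add0r sqrtr1.
Qed.

Lemma cabs_le_directions z (t : R) :
  (forall u, u \in directions -> complex.Re (u * z) <= t) -> cabs z <= 2 * t.
Proof.
case: z => a b le_t.
have c_ge0 := cabs_ge0 (a +i* b); have := cabs_sqr (a +i* b).
move: (cabs _) c_ge0 => c c_ge0 /= c_sqr.
have h1 := le_t 1; have h2 := le_t (-1); have h3 := le_t 'i.
have h4 := le_t (- 'i); move: h1 h2 h3 h4.
rewrite /directions !inE !eqxx !orbT /= => /(_ isT) h1 /(_ isT) h2.
move=> /(_ isT) h3 /(_ isT) h4; move: h1 h2 h3 h4.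
rewrite !(mul0r, mulN1r, mul1r, oppr0, sub0r, subr0, opprK, mulNr).
move=> h1 h2 h3 h4; have t_ge0 : 0 <= t by lra.
by rewrite -ler_sqr ?nnegrE ?mulr_ge0 // c_sqr; nra.
Qed.

Lemma CauchySchwarz_sum (I : finType) (P : pred I) (a b : I -> R) :
  \sum_(i | P i) a i * b i <=
  Num.sqrt (\sum_(i | P i) a i ^+ 2) * Num.sqrt (\sum_(i | P i) b i ^+ 2).
Proof.
have sum_ge0 (c : I -> R) : 0 <= \sum_(i | P i) c i ^+ 2.
  by apply: sumr_ge0 => i _; apply: sqr_ge0.
rewrite -sqrtrM //; apply: le_trans (ler_norm _) _.
rewrite -sqrtr_sqr ler_wsqrtr //.
(* Lagrange's identity: this double sum equals 2 (X Y - W^2) in the notation set below. *)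
have: 0 <= \sum_(i | P i) \sum_(j | P j) (a i * b j - a j * b i) ^+ 2.
  by apply: sumr_ge0 => i _; apply: sumr_ge0 => j _; apply: sqr_ge0.
rewrite (eq_bigr (fun i => a i ^+ 2 * (\sum_(j | P j) b j ^+ 2) +
   b i ^+ 2 * (\sum_(j | P j) a j ^+ 2) -
   2 * (a i * b i) * (\sum_(j | P j) a j * b j))); last first.
  move=> i _; rewrite !mulr_sumr -big_split /= -sumrB.
  by apply: eq_bigr => j _; ring.
rewrite sumrB big_split /= -!mulr_suml -mulr_sumr.
set X := \sum_(i | P i) a i ^+ 2; set Y := \sum_(i | P i) b i ^+ 2.
set W := \sum_(i | P i) _; nra.
Qed.

Definition l2norm q (v : 'cV[R[i]]_q) : R :=
  Num.sqrt (\sum_(i < q) cabs (v i ord0) ^+ 2).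

Lemma l2norm_ge0 q (v : 'cV[R[i]]_q) : 0 <= l2norm v.
Proof. exact: sqrtr_ge0. Qed.

Lemma l2norm_sqr q (v : 'cV[R[i]]_q) :
  l2norm v ^+ 2 = \sum_(i < q) cabs (v i ord0) ^+ 2.
Proof. by rewrite sqr_sqrtr // sumr_ge0 // => i _; apply: sqr_ge0. Qed.

Lemma l2norm_eq0 q (v : 'cV[R[i]]_q) : l2norm v = 0 -> v = 0.
Proof.
move=> v0; apply/colP => j; rewrite mxE; apply/eqP; rewrite -cabs_eq0.
have /eqP := l2norm_sqr v; rewrite v0 expr0n /= eq_sym psumr_eq0 => [|i _].
  by move=> /allP /(_ j); rewrite mem_index_enum sqrf_eq0 => /(_ isT).
exact: sqr_ge0.
Qed.

Lemma innerE q (v w : 'cV[R[i]]_q) :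
  inner v w = \sum_(j < q) Num.conj (v j ord0) * w j ord0.
Proof. by rewrite /inner mxE; apply: eq_bigr => j _; rewrite !mxE. Qed.

Lemma innerDl q (v v' w : 'cV[R[i]]_q) :
  inner (v + v') w = inner v w + inner v' w.
Proof.
rewrite !innerE -big_split; apply: eq_bigr => j _.
by rewrite mxE rmorphD mulrDl.
Qed.

Lemma isometry_l2norm p q (A : 'M[R[i]]_(p, q)) (v : 'cV[R[i]]_q) :
  A^t* *m A = 1%:M -> l2norm (A *m v) = l2norm v.
Proof.
move=> A_isom; congr Num.sqrt; apply/complexI.
have sumE n (w : 'cV[R[i]]_n) : (\sum_i cabs (w i ord0) ^+ 2)%:C = inner w w.
  by rewrite innerE rmorph_sum; apply: eq_bigr => i _; rewrite mul_conj_cabs.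
rewrite !sumE /inner trmx_mul map_mxM.
by rewrite -mulmxA (mulmxA _ A) A_isom mul1mx.
Qed.

End ComplexVectors.

(** * Inexact dual certificates *)

Section Certificates.
Context {R : realType} {p q : nat}.
Variables (A : 'M[R[i]]_(p, q)) (S : {set 'I_q}) (s : nat).
Hypotheses (s_gt0 : (0 < s)%N) (card_S : (#|S| <= s)%N).
Implicit Types (v w h : 'cV[R[i]]_q) (xs : seq 'I_p).

Let r : R := Num.sqrt s%:R.

Let r_gt0 : 0 < r.
Proof. by rewrite sqrtr_gt0 ltr0n. Qed.

Let r_sqr : r ^+ 2 = s%:R.
Proof. by rewrite sqr_sqrtr. Qed.

Definition supported v := forall j, j \notin S -> v j ord0 = 0.

Definition proj v : 'cV[R[i]]_q :=
  \col_j (if j \in S then v j ord0 else 0).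

Lemma supported_proj v : supported (proj v).
Proof. by move=> j /negbTE jS; rewrite mxE jS. Qed.

Lemma proj_id v : supported v -> proj v = v.
Proof.
move=> v_supp; apply/colP => j; rewrite mxE.
by case: ifP => // /negbT /v_supp.
Qed.

Lemma l2norm_supported v :
  supported v -> l2norm v = Num.sqrt (\sum_(j in S) cabs (v j ord0) ^+ 2).
Proof.
move=> v_supp; congr Num.sqrt; rewrite [RHS]big_mkcond; apply: eq_bigr => j _.
by case: ifP => // /negbT /v_supp ->; rewrite cabs0 expr0n.
Qed.

Lemma l2norm_proj v :
  l2norm (proj v) = Num.sqrt (\sum_(j in S) cabs (v j ord0) ^+ 2).
Proof.
rewrite (l2norm_supported (@supported_proj v)); congr Num.sqrt.
by apply: eq_bigr => j jS; rewrite mxE jS.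
Qed.

Lemma l2norm_proj_le v (c : R) :
  0 <= c -> (forall j, j \in S -> cabs (v j ord0) <= c) ->
  l2norm (proj v) <= r * c.
Proof.
move=> c_ge0 v_le; have rc_ge0 : 0 <= r * c by rewrite mulr_ge0 // ltW.
rewrite l2norm_proj -[r * c]ger0_norm // -sqrtr_sqr ler_wsqrtr //.
apply: le_trans (_ : \sum_(j in S) c ^+ 2 <= _).
  by apply: ler_sum => j jS; rewrite lerXn2r ?nnegrE ?cabs_ge0 ?v_le.
rewrite sumr_const -[leLHS]mulr_natl exprMn r_sqr.
by rewrite ler_wpM2r ?sqr_ge0 // ler_nat.
Qed.

Lemma sum_cabs_supported v :
  supported v -> \sum_j cabs (v j ord0) <= r * l2norm v.
Proof.
move=> v_supp; rewrite (bigID (mem S)) /= [X in _ + X]big1 => [|j /v_supp ->].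
  rewrite addr0 l2norm_supported //.
  under eq_bigr do rewrite -[cabs _]mul1r.
  apply: le_trans (CauchySchwarz_sum _ _ _) _.
  rewrite ler_wpM2r ?sqrtr_ge0 // ler_wsqrtr //.
  by rewrite expr1n sumr_const ler_nat.
exact: cabs0.
Qed.

(** Says by duality that [w] lies in the span of the conjugated rows of [A] indexed by [xs], without
    exhibiting coefficients. *)
Definition annihilating xs w :=
  forall h, (forall x, x \in xs -> (A *m h) x ord0 = 0) -> inner w h = 0.

(** The tolerances scale with the norm of [v], so that the sign vector (norm at most [r]) and the
    basis vectors (norm 1) are treated alike. *)
Definition certified xs v := exists w,
  [/\ annihilating xs w, l2norm (proj (w - v)) <= l2norm v / (4 * r)
    & forall j, j \notin S -> cabs (w j ord0) <= l2norm v / (7 * r)].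

(** As [w] is orthogonal to [h], the pairing of [v] with [h] is minus that of [w - v].
    Cauchy-Schwarz bounds the part on [S]; off [S], [w - v] is just [w]. *)
Lemma certified_inner xs v h :
  supported v -> certified xs v ->
  (forall x, x \in xs -> (A *m h) x ord0 = 0) ->
  cabs (inner v h) <= l2norm v *
    (l2norm (proj h) / 4 + (\sum_(j | j \notin S) cabs (h j ord0)) / 7) / r.
Proof.
move=> v_supp [w [w_ann w_on w_off]] h_ker; have n_ge0 := l2norm_ge0 v.
have -> : inner v h = - inner (w - v) h.
  have := innerDl (w - v) v h.
  rewrite subrK (w_ann _ h_ker) => /esym /eqP.
  by rewrite addr_eq0 => /eqP ->; rewrite opprK.
rewrite cabsN innerE; apply: le_trans (le_cabs_sum _ _ _) _.
rewrite (bigID (mem S)) /=.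
have -> : l2norm v * (l2norm (proj h) / 4 +
    (\sum_(j | j \notin S) cabs (h j ord0)) / 7) / r =
  l2norm v / (4 * r) * l2norm (proj h) +
  l2norm v / (7 * r) * \sum_(j | j \notin S) cabs (h j ord0).
  by field; rewrite gt_eqF.
apply: lerD.
  apply: le_trans (ler_wpM2r (l2norm_ge0 _) w_on).
  rewrite !l2norm_proj.
  under eq_bigr do rewrite cabsM cabs_conj.
  exact: (CauchySchwarz_sum (mem S) (fun j => cabs ((w - v) j ord0))).
rewrite mulr_sumr; apply: ler_sum => j jS; rewrite cabsM cabs_conj.
by rewrite ler_wpM2r ?cabs_ge0 // !mxE v_supp // oppr0 addr0 w_off.
Qed.

Definition basis_vec (k : 'I_q) : 'cV[R[i]]_q := delta_mx k ord0.

(** Division by zero yields 0, so the sign vector vanishes wherever [a] does. *)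
Definition sign_vec (a : 'cV[R[i]]_q) : 'cV[R[i]]_q :=
  \col_j (a j ord0 / (cabs (a j ord0))%:C).

Lemma supported_basis_vec k : k \in S -> supported (basis_vec k).
Proof.
move=> kS j jS; rewrite mxE andbT; case: eqP => // jk.
by rewrite jk kS in jS.
Qed.

Lemma supported_sign_vec a : supported a -> supported (sign_vec a).
Proof. by move=> a_supp j jS; rewrite mxE a_supp // mul0r. Qed.

Lemma l2norm_basis_vec k : l2norm (basis_vec k) = 1.
Proof.
rewrite /l2norm (bigD1 k) //= big1 => [|j /negbTE jk].
  by rewrite mxE !eqxx cabs_real // expr1n addr0 sqrtr1.
by rewrite mxE jk cabs0 expr0n.
Qed.

Lemma l2norm_sign_vec a : supported a -> l2norm (sign_vec a) <= r.
Proof.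
move=> a_supp; rewrite -(proj_id (supported_sign_vec a_supp)).
rewrite -[leRHS]mulr1; apply: l2norm_proj_le => // j _; rewrite mxE cabsM.
have [->|a_neq0] := eqVneq (a j ord0) 0; first by rewrite cabs0 mul0r.
have ca_gt0 : 0 < cabs (a j ord0) by rewrite lt0r cabs_eq0 a_neq0 cabs_ge0.
by rewrite -fmorphV cabs_real ?invr_ge0 ?cabs_ge0 // divff // lt0r_neq0.
Qed.

(** The subgradient inequality for the modulus: multiplying by the conjugate sign makes the entry of
    [a] real and nonnegative, and a real part is at most the modulus. *)
Lemma sign_vec_le (a h : 'cV[R[i]]_q) j :
  cabs (a j ord0) + complex.Re (Num.conj (sign_vec a j ord0) * h j ord0) <=
  cabs (a j ord0 + h j ord0).
Proof.
rewrite mxE; have [->|a_neq0] := eqVneq (a j ord0) 0.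
  by rewrite mul0r rmorph0 mul0r cabs0 !add0r cabs_ge0.
have ca_gt0 : 0 < cabs (a j ord0) by rewrite lt0r cabs_eq0 a_neq0 cabs_ge0.
set u := a j ord0 / _.
have u1 : cabs u = 1.
  rewrite /u cabsM -fmorphV cabs_real ?invr_ge0 ?cabs_ge0 // divff //.
  exact: lt0r_neq0.
have -> : cabs (a j ord0 + h j ord0) =
    cabs (Num.conj u * (a j ord0 + h j ord0)).
  by rewrite cabsM cabs_conj u1 mul1r.
apply: le_trans (Re_le_cabs _); rewrite mulrDr ReD lerD2r.
have -> : Num.conj u * a j ord0 = (cabs (a j ord0))%:C.
  have {1}-> : a j ord0 = u * (cabs (a j ord0))%:C.
    by rewrite /u divfK // fmorph_eq0 lt0r_neq0.
  by rewrite mulrA mul_conj_cabs u1 expr1n mul1r.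
by [].
Qed.

(** Off [S] the norm grows by [T]; on [S] it drops by at most [H / 4 + T / 7]. Since
    [H <= H / 4 + T / 7] gives [H <= 4 T / 21], the drop is at most [4 T / 21], less than [T]. *)
Lemma certified_l1norm_lt xs (a h : 'cV[R[i]]_q) :
  supported a -> certified xs (sign_vec a) ->
  (forall k, k \in S -> certified xs (basis_vec k)) ->
  (forall x, x \in xs -> (A *m h) x ord0 = 0) ->
  h != 0 -> l1norm a < l1norm (a + h).
Proof.
move=> a_supp cert_a cert_e h_ker h_neq0.
set H := l2norm (proj h); set T := \sum_(j | j \notin S) cabs (h j ord0).
have H_ge0 : 0 <= H := l2norm_ge0 _.
have T_ge0 : 0 <= T by apply: sumr_ge0 => j _; apply: cabs_ge0.
(* The certificates of the basis vectors bound each h_k with k in S; they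
   replace a lower bound on the smallest singular value of the columns in S. *)
have H_le : H <= H / 4 + T / 7.
  have c_ge0 : 0 <= (H / 4 + T / 7) / r.
    by rewrite divr_ge0 ?addr_ge0 ?divr_ge0 // ltW.
  rewrite -[leRHS](divfK (lt0r_neq0 r_gt0)) mulrC.
  apply: l2norm_proj_le => // k kS.
  have := certified_inner (supported_basis_vec kS) (cert_e k kS) h_ker.
  rewrite l2norm_basis_vec mul1r innerE (bigD1 k) //= big1 => [|j /negbTE jk].
    by rewrite mxE !eqxx rmorph1 mul1r addr0.
  by rewrite mxE jk rmorph0 mul0r.
have T_gt0 : 0 < T.
  rewrite lt0r T_ge0 andbT; apply: contraNneq h_neq0 => T0.
  have H0 : H = 0 by lra.
  apply/eqP/colP => j; rewrite [RHS]mxE; have [jS|jS] := boolP (j \in S).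
    have /colP /(_ j) := l2norm_eq0 H0.
    by rewrite !mxE jS.
  move/eqP: T0; rewrite psumr_eq0 => [|i _]; last exact: cabs_ge0.
  by move=> /allP /(_ j); rewrite mem_index_enum jS cabs_eq0 => /(_ isT) /eqP.
have inner_le : cabs (inner (sign_vec a) h) <= H / 4 + T / 7.
  have := certified_inner (supported_sign_vec a_supp) cert_a h_ker.
  move=> /le_trans; apply; rewrite ler_pdivrMr // mulrC.
  apply: ler_wpM2l (l2norm_sign_vec a_supp).
  by rewrite addr_ge0 ?divr_ge0.
have: l1norm a + complex.Re (inner (sign_vec a) h) + T <= l1norm (a + h).
  rewrite /l1norm innerE Re_sum -big_split /= (bigID (mem S)) /=.
  rewrite [X in _ + X + _]big1 => [|j jS]; last first.
    by rewrite supported_sign_vec // a_supp // rmorph0 mul0r cabs0 addr0.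
  rewrite addr0 [leRHS](bigID (mem S)) /=.
  apply: lerD; apply: ler_sum => j jS; rewrite [(a + h) _ _]mxE.
    exact: sign_vec_le.
  by rewrite a_supp // add0r.
have := Re_le_cabs (- inner (sign_vec a) h); rewrite cabsN.
have -> : complex.Re (- inner (sign_vec a) h) =
    - complex.Re (inner (sign_vec a) h).
  by case: (inner _ _).
lra.
Qed.

End Certificates.

(** * Golfing *)

Section Golfing.
Context {R : realType} {p q : nat}.
Variables (A : 'M[R[i]]_(p, q)) (mu : R) (S : {set 'I_q}) (s b : nat).
Hypothesis A_isom : A^t* *m A = 1%:M.
Hypotheses (A_coh : forall x j, cabs (A x j) <= mu) (mu_gt0 : 0 < mu).
Hypotheses (p_gt0 : (0 < p)%N) (b_gt0 : (0 < b)%N).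
Hypotheses (s_gt0 : (0 < s)%N) (card_S : (#|S| <= s)%N).
Implicit Types (v w h : 'cV[R[i]]_q) (xs ys : seq 'I_p).

Let r : R := Num.sqrt s%:R.

Let r_gt0 : 0 < r.
Proof. by rewrite sqrtr_gt0 ltr0n. Qed.

Let r_sqr : r ^+ 2 = s%:R.
Proof. by rewrite sqr_sqrtr. Qed.

(** Scaled so that its average over [b] uniform samples is [A^t* A v], which is [v] for an
    isometry. *)
Definition gram xs v : 'cV[R[i]]_q :=
  \col_j ((p%:R / b%:R)%:C *
          \sum_(x <- xs) (A^t*) j x * (A *m v) x ord0).

(** The sup-norm runs over all coordinates: on [S] it yields the contraction of the residual, off
    [S] the smallness of the certificate. *)
Definition accurate xs v : bool :=
  [forall j, cabs (gram xs v j ord0 - v j ord0) <= l2norm v / (8 * r)].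

Definition golf_step xs v : 'cV[R[i]]_q :=
  if accurate xs v then proj S (v - gram xs v) else v.

(* Golfing consumes the samples in batches of length b; a batch that is not
   accurate for the current residual is discarded, and counted here. *)
Fixpoint failures (k : nat) xs v : nat :=
  if k is k'.+1 then
    ~~ accurate (take b xs) v +
    failures k' (drop b xs) (golf_step (take b xs) v)
  else 0.

Lemma supported_golf_step xs v : supported S v -> supported S (golf_step xs v).
Proof.
by move=> v_supp; rewrite /golf_step; case: ifP => // _; apply: supported_proj.
Qed.

Lemma l2norm_golf_step xs v :
  accurate xs v -> l2norm (golf_step xs v) <= l2norm v / 8.
Proof.
move=> acc; rewrite /golf_step acc.
have -> : l2norm v / 8 = r * (l2norm v / (8 * r)) by field; rewrite gt_eqF.
apply: l2norm_proj_le => //.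
  by rewrite divr_ge0 ?l2norm_ge0 // mulr_ge0 // ltW.
move=> j _; rewrite !mxE -cabsN opprB.
by have /forallP /(_ j) := acc; rewrite mxE.
Qed.

Lemma annihilating_gram xs ys v :
  {subset xs <= ys} -> annihilating A ys (gram xs v).
Proof.
move=> sub_xs h h_ker; rewrite innerE.
pose c x := (p%:R / b%:R)%:C * Num.conj ((A *m v) x ord0).
transitivity (\sum_(x <- xs) c x * (A *m h) x ord0).
  under [RHS]eq_bigr do rewrite [X in _ * X]mxE mulr_sumr.
  rewrite exchange_big; apply: eq_bigr => j _.
  rewrite mxE rmorphM rmorph_sum /= conj_real.
  rewrite mulr_sumr mulr_suml.
  apply: eq_bigr => x _.
  have AxjE : Num.conj ((A^t*) j x) = A x j by rewrite !mxE conjCK.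
  rewrite conjM AxjE /c.
  by ring.
rewrite big_seq big1 // => x /sub_xs /h_ker ->; exact: mulr0.
Qed.

Lemma failures_le k xs v : (failures k xs v <= k)%N.
Proof.
elim: k xs v => // k IH xs v /=.
by apply: leq_trans (leq_add (leq_b1 _) (IH _ _)) _.
Qed.

(** The certificate is the sum of the [gram] vectors of the accurate batches, each taken at the
    current residual. Every success shrinks the residual by 8, so the terms off [S] form a geometric
    series with sum at most [l2norm v / (7 * r)]. *)
Lemma golf_certificate k xs v :
  supported S v -> exists w,
  [/\ annihilating A xs w,
      l2norm (proj S (w - v)) <= 8^-1 ^+ (k - failures k xs v) * l2norm v
    & forall j, j \notin S -> cabs (w j ord0) <= l2norm v / (7 * r)].
Proof.
have c_gt0 : 0 < 7 * r by rewrite mulr_gt0.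
elim: k xs v => [|k IH] xs v v_supp.
  exists 0; split=> [h _||j _].
  - by rewrite innerE big1 // => j _; rewrite mxE rmorph0 mul0r.
  - rewrite sub0r expr0 mul1r -{2}(proj_id v_supp) !l2norm_proj.
    by under eq_bigr do rewrite mxE cabsN.
  - by rewrite mxE cabs0 divr_ge0 ?l2norm_ge0 // ltW.
have := IH (drop b xs) _ (supported_golf_step (take b xs) v_supp).
have sub_drop w : annihilating A (drop b xs) w -> annihilating A xs w.
  by move=> w_ann h h_ker; apply: w_ann => x /mem_drop; apply: h_ker.
have := failures_le k (drop b xs) (golf_step (take b xs) v).
rewrite /=; set f := failures _ _ _ => f_le.
(* A discarded batch leaves the residual unchanged, so the certificate from the remaining samples is
   kept. *)
case: (boolP (accurate (take b xs) v)) => acc [w [w_ann w_on w_off]]; last first.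
  move: w_on w_off; rewrite /golf_step (negbTE acc) => w_on w_off.
  by exists w; split=> //; exact: sub_drop.
have step_le := l2norm_golf_step acc.
exists (gram (take b xs) v + w); split=> [h h_ker||j jS].
- rewrite innerDl (sub_drop _ w_ann) // addr0.
  by apply: (annihilating_gram v _ h_ker) => x; apply: mem_take.
- have -> : proj S (gram (take b xs) v + w - v) =
            proj S (w - golf_step (take b xs) v).
    apply/colP => j; rewrite /golf_step acc !mxE; case: ifP => // _.
    by ring.
  apply: le_trans w_on _; rewrite add0n subSn // exprS -mulrA mulrCA.
  by apply: ler_wpM2l; rewrite ?exprn_ge0 ?invr_ge0 // mulrC.
- have := forallP acc j; rewrite v_supp // subr0 => gram_le.
  rewrite mxE; apply: le_trans (le_cabsD _ _) _.
  apply: le_trans (lerD gram_le (w_off j jS)) _.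
  (* The fixed point of the series: 1/7 = 1/8 + (1/8)(1/7). *)
  have -> : l2norm v / (7 * r) = l2norm v / (8 * r) + l2norm v / 8 / (7 * r).
    by field; rewrite gt_eqF.
  by rewrite lerD2l ler_pM2r // invr_gt0.
Qed.

Lemma sum_gram_terms v j :
  (\sum_x (p%:R)%:C * ((A^t*) j x * (A *m v) x ord0)) =
  (p%:R)%:C * v j ord0.
Proof.
rewrite -mulr_sumr; congr (_ * _).
have -> : v j ord0 = (A^t* *m (A *m v)) j ord0 by rewrite mulmxA A_isom mul1mx.
by rewrite [RHS]mxE.
Qed.

(* One Bernstein bound per coordinate j and direction u, applied to
   Re (u * p * conj (A x j) * (A v) x), whose second moment is at most
   p mu^2 |v|^2 and which is bounded by p mu^2 sqrt s |v| as v is supported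
   on S. *)
Lemma inaccurate_prob v :
  supported S v ->
  avg b (fun xs => (~~ accurate xs v)%:R : R) <=
  (4 * q)%:R * expR (- (b%:R / (2048 * (p%:R * mu ^+ 2) * s%:R))).
Proof.
move=> v_supp; set K := p%:R * mu ^+ 2; set e := expR _.
have K_gt0 : 0 < K by rewrite mulr_gt0 ?ltr0n ?exprn_gt0.
have p_gt0' : 0 < p%:R :> R by rewrite ltr0n.
have b_gt0' : 0 < b%:R :> R by rewrite ltr0n.
set n := l2norm v; have n_ge0 : 0 <= n := l2norm_ge0 v.
(* The zero vector is estimated exactly; it is set apart because [theta] divides by [n]. *)
have [n0|n_neq0] := eqVneq n 0.
  rewrite (eq_avg (G := fun=> 0)) => [|xs _].
    by rewrite avg_cst ?card_ord // mulr_ge0 // expR_ge0.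
  suff -> : accurate xs v by [].
  apply/forallP => j; rewrite (l2norm_eq0 n0) !mxE subr0.
  rewrite big1 => [|x _]; last by rewrite mulmx0 !mxE mulr0.
  by rewrite mulr0 cabs0 divr_ge0 ?l2norm_ge0 // mulr_ge0 // ltW.
have n_gt0 : 0 < n by rewrite lt0r n_neq0.
pose g j x : R[i] := (A^t*) j x * (A *m v) x ord0.
pose Z j u x := complex.Re (u * ((p%:R)%:C * g j x)).
pose mean j u := complex.Re (u * v j ord0).
(* [tau] is half the tolerance, to pay for the factor 2 of [cabs_le_directions]. With [V = K n^2],
   [theta = tau / (4 V)] minimizes the Bernstein exponent, whose value per sample is
   [- tau^2 / (8 V) = - 1 / (2048 K s)]. *)
pose tau := n / (16 * r); pose theta := (64 * K * r * n)^-1.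
have theta_gt0 : 0 < theta by rewrite invr_gt0 !mulr_gt0.
have cabs_g j x : cabs (g j x) <= mu * cabs ((A *m v) x ord0).
  by rewrite cabsM ler_wpM2r ?cabs_ge0 // !mxE cabs_conj.
have cabs_Z j u x : u \in directions ->
    `|Z j u x| <= p%:R * mu * cabs ((A *m v) x ord0).
  move=> u_dir; have cabs_w : cabs (u * ((p%:R)%:C * g j x)) <=
      p%:R * mu * cabs ((A *m v) x ord0).
    rewrite 2!cabsM (cabs_directions u_dir) mul1r cabs_real ?ler0n // -mulrA.
    by rewrite ler_wpM2l ?ler0n.
  have := Re_le_cabs (- (u * ((p%:R)%:C * g j x))); rewrite cabsN.
  have -> : complex.Re (- (u * ((p%:R)%:C * g j x))) = - Z j u x.
    by rewrite /Z; case: (_ * _).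
  have := Re_le_cabs (u * ((p%:R)%:C * g j x)); rewrite -/(Z j u x).
  by rewrite ler_norml; lra.
(* Union bound over the [4 * q] pairs of a coordinate and a direction. *)
have bad_le xs : (~~ accurate xs v)%:R <= \sum_(j < q) \sum_(u <- directions)
    (b%:R * (mean j u + tau) < \sum_(x <- xs) Z j u x)%R%:R :> R.
  have sum_ge0 (j : 'I_q) : 0 <= \sum_(u <- directions)
      (b%:R * (mean j u + tau) < \sum_(x <- xs) Z j u x)%R%:R :> R.
    by apply: sumr_ge0 => u _; apply: ler0n.
  case: (boolP (accurate xs v)) => [_|]; first by apply: sumr_ge0 => j _.
  rewrite negb_forall => /existsP[j]; rewrite -ltNge => far.
  have /hasP[u u_dir far_u] : has (fun u => b%:R * (mean j u + tau) <
      \sum_(x <- xs) Z j u x) (@directions R).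
    apply: contraTT far => /hasPn near; rewrite -leNgt.
    have -> : n / (8 * r) = 2 * tau by rewrite /tau; field; rewrite gt_eqF.
    apply: cabs_le_directions => u /near; rewrite -leNgt /mean.
    have -> : \sum_(x <- xs) Z j u x =
        b%:R * complex.Re (u * gram xs v j ord0).
      rewrite -Re_sum -2!mulr_sumr mxE -/(g j) rmorphM fmorphV mulrA.
      set G := \sum_(x <- xs) _.
      have Re_scale (c : R) z : c * complex.Re z = complex.Re (c%:C * z).
        by case: z => ? ?; rewrite /= mul0r subr0.
      rewrite Re_scale; congr complex.Re.
      by field; rewrite pnatr_eq0 -lt0n.
    rewrite (ler_pM2l b_gt0') mulrBr ReD.
    have -> : complex.Re (- (u * v j ord0)) = - complex.Re (u * v j ord0).
      by case: (_ * _).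
    by lra.
  rewrite (bigD1 j) //= (big_rem u u_dir) /=.
  rewrite far_u -addrA lerDl addr_ge0 ?sumr_ge0 // => i _; exact: ler0n.
apply: le_trans (le_avg (fun xs _ => bad_le xs)) _.
rewrite avg_sum.
have -> : (4 * q)%:R * e = \sum_(j < q) \sum_(u <- @directions R) e.
  rewrite !big_cons big_nil sumr_const card_ord -mulr_natl natrM; ring.
apply: ler_sum => j _; rewrite avg_sum big_seq [leRHS]big_seq.
apply: ler_sum => u u_dir.
apply: le_trans (bernstein (V := K * n ^+ 2) (theta := theta) b tau _ _ _ _ _) _.
- by rewrite card_ord.
- exact: ltW.
- move=> x; apply: le_trans (_ : theta * (p%:R * mu * (mu * (r * n))) <= _).
    rewrite ler_pM2l //; apply: le_trans (ler_norm _) _.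
    apply: le_trans (cabs_Z j u x u_dir) _.
    rewrite ler_pM2l ?mulr_gt0 //.
    rewrite mxE; apply: le_trans (le_cabs_sum _ _ _) _.
    apply: le_trans (_ : mu * \sum_k cabs (v k ord0) <= _).
      rewrite mulr_sumr; apply: ler_sum => k _.
      by rewrite cabsM ler_wpM2r ?cabs_ge0.
    by rewrite ler_pM2l //; apply: (sum_cabs_supported card_S).
  have -> : theta * (p%:R * mu * (mu * (r * n))) = 64^-1.
    by rewrite /theta /K; field; rewrite !gt_eqF.
  by lra.
- rewrite card_ord -Re_sum -mulr_sumr sum_gram_terms /mean.
  rewrite mulrCA; case: (u * _) => ? ? /=.
  by rewrite mul0r subr0 mulrC mulKf ?gt_eqF.
- rewrite card_ord ler_pdivrMr //.
  apply: le_trans (_ : \sum_x (p%:R * mu) ^+ 2 * cabs ((A *m v) x ord0) ^+ 2 <= _).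
    apply: ler_sum => x _; rewrite -exprMn -[leLHS]real_normK ?num_real //.
    by rewrite lerXn2r ?nnegrE ?mulr_ge0 ?cabs_ge0 ?cabs_Z // ltW.
  by rewrite -mulr_sumr -l2norm_sqr isometry_l2norm // -/n /K; nra.
rewrite ler_expR /tau /theta -r_sqr le_eqVlt; apply/orP; left; apply/eqP.
by field; rewrite !gt_eqF.
Qed.

(** Condition on the first batch: the new residual is again supported on [S] and is tested on fresh
    samples, so [eps] applies uniformly and each batch costs one factor. The summand [m] allows
    sample counts that are not multiples of [b]. *)
Lemma failures_mgf k m v (lambda eps : R) :
  1 <= lambda -> 0 <= eps ->
  (forall v, supported S v ->
     avg b (fun xs => (~~ accurate xs v)%:R : R) <= eps) ->
  supported S v ->
  avg (k * b + m) (fun xs => lambda ^+ failures k xs v) <=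
  (1 + lambda * eps) ^+ k.
Proof.
move=> lambda_ge1 eps_ge0 step_prob; elim: k v => [|k IH] v v_supp.
  by rewrite /= (eq_avg (G := fun=> 1)) // avg_cst ?card_ord.
have base_ge0 : 0 <= 1 + lambda * eps by nra.
rewrite mulSn -addnA avg_cat.
apply: le_trans (_ : avg b (fun xs => (1 + lambda * eps) ^+ k *
   (1 + lambda * (~~ accurate xs v)%:R)) <= _).
  apply: le_avg => xs size_xs.
  rewrite (eq_avg (G := fun ys => lambda ^+ (~~ accurate xs v) *
     lambda ^+ failures k ys (golf_step xs v))) => [|ys _]; last first.
    by rewrite /= take_size_cat // drop_size_cat // exprD.
  rewrite avgZ mulrC; apply: ler_pM; rewrite ?exprn_ge0 //; try lra.
  - rewrite -[leLHS](avg_cst (k * b + m) (T := 'I_p)) ?card_ord //.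
    by apply: le_avg => ys _; rewrite exprn_ge0 //; lra.
  - exact: IH (supported_golf_step _ v_supp).
  - by case: (accurate xs v); rewrite /= ?expr0 ?expr1; lra.
rewrite avgZ avgD avgZ avg_cst ?card_ord // exprSr.
rewrite ler_wpM2l ?exprn_ge0 // lerD2l ler_wpM2l ?step_prob //; lra.
Qed.

(* Markov's inequality for eps^-1 ^+ failures. *)
Lemma failures_tail k m v (eps : R) :
  0 < eps <= 1 ->
  (forall v, supported S v ->
     avg b (fun xs => (~~ accurate xs v)%:R : R) <= eps) ->
  supported S v ->
  avg (k.*2 * b + m) (fun xs => (k <= failures k.*2 xs v)%N%:R : R) <=
  (4 * eps) ^+ k.
Proof.
move=> /andP[eps_gt0 eps_le1] step_prob v_supp.
have inv_ge1 : 1 <= eps^-1 by rewrite invf_ge1.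
apply: le_trans (_ : avg (k.*2 * b + m)
   (fun xs => eps ^+ k * eps^-1 ^+ failures k.*2 xs v) <= _).
  apply: le_avg => xs _; case: leqP => [k_le|_].
    rewrite -ler_pdivrMl ?exprn_gt0 // mulr1 -exprVn.
    by apply: ler_weXn2l.
  by rewrite mulr_ge0 ?exprn_ge0 ?invr_ge0 // ltW.
(* At [lambda = eps^-1] each of the [2 k] factors is 2, which leaves [eps^k 4^k]. *)
rewrite avgZ; have := failures_mgf k.*2 m inv_ge1 (ltW eps_gt0) step_prob v_supp.
rewrite mulVf ?gt_eqF // -mul2n exprM -[1 + 1]/(2 : R).
move=> /(ler_wpM2l (exprn_ge0 k (ltW eps_gt0))) /le_trans; apply.
by rewrite -exprMn (_ : eps * 2 ^+ 2 = 4 * eps) //; ring.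
Qed.

End Golfing.

(** * Recovery for isometries with bounded entries *)

Section Recovery.
Context {R : realType}.

Lemma expR_half_le2 : expR (1 / 2) <= 2 :> R.
Proof. have := expR_le_quadratic (lexx (1 / 2 : R)); lra. Qed.

Lemma ln_ge_half (q : nat) : (1 < q)%N -> 1 / 2 <= ln q%:R :> R.
Proof.
move=> q_gt1; have q_gt0 : 0 < q%:R :> R by rewrite ltr0n ltnW.
rewrite -ler_expR lnK ?posrE //; apply: le_trans expR_half_le2 _.
by rewrite ler_nat.
Qed.

Lemma le_4cube (x : R) : 1 / 2 <= x -> x <= 4 * x ^+ 3.
Proof. by move=> x_ge; nra. Qed.

(** Ensures that [k] contractions by 8 reach the tolerance [1 / (4 r)] of [certified]. After
    squaring, 16 s is compared with 16^k 4^k. *)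
Lemma sqrt_le_expn8 (s k : nat) :
  (0 < k)%N -> (s <= 4 ^ k)%N -> 4 * Num.sqrt s%:R <= 8 ^+ k :> R.
Proof.
move=> k_gt0 s_le; have s_ge0 : 0 <= Num.sqrt s%:R :> R by apply: sqrtr_ge0.
rewrite -ler_sqr ?nnegrE ?mulr_ge0 ?exprn_ge0 // exprMn sqr_sqrtr //.
rewrite -exprM mulnC exprM (_ : 8 ^+ 2 = 4 ^+ 2 * 4); last by ring.
rewrite exprMn ler_pM ?exprn_ge0 //; last by rewrite -natrX ler_nat.
by rewrite ler_eXnr //; rewrite ?exprn_ege1 //; lra.
Qed.

Lemma unique_minimizer_of_certified p q (A : 'M[R[i]]_(p, q)) (S : {set 'I_q})
    (s m : nat) (a : 'cV[R[i]]_q) (l : {ffun 'I_m -> 'I_p}) :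
  (0 < s)%N -> (#|S| <= s)%N -> supported S a ->
  certified A S s (codom l) (sign_vec a) ->
  (forall k, k \in S -> certified A S s (codom l) (basis_vec k)) ->
  is_unique_l1_minimizer (sample_rows l A) (sample_rows l A *m a) a.
Proof.
move=> s_gt0 card_S a_supp cert_a cert_e.
have lt_l1 a' : sample_rows l A *m a = sample_rows l A *m a' -> a' != a ->
    l1norm a < l1norm a'.
  move=> eq_y neq_a; rewrite -[a'](subrKC a).
  apply: (certified_l1norm_lt s_gt0 card_S a_supp cert_a cert_e); last first.
    by rewrite subr_eq0.
  move=> _ /codomP[t ->]; move/colP: eq_y => /(_ t).
  have sampleE c : (sample_rows l A *m c) t ord0 = (A *m c) (l t) ord0.
    by rewrite !mxE; apply: eq_bigr => j _; rewrite mxE.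
  rewrite !sampleE mulmxBr => eq_t.
  by rewrite mxE [X in _ + X]mxE eq_t subrr.
split=> [|a' [eq_y min_a']].
  split=> // a' eq_y; have [->//|neq_a] := eqVneq a' a.
  exact/ltW/lt_l1.
apply/eqP; apply: contraT => neq_a.
have := lt_l1 a' eq_y neq_a; rewrite ltNge => /negP; case.
exact: min_a'.
Qed.

(** [F] lies below the indicator of [E] and may be negative, so one minus a sum of failure
    indicators can be used directly as a union bound. *)
Lemma iid_uniform_prob_ge m p (E : {ffun 'I_m -> 'I_p} -> Prop)
    (F : seq 'I_p -> R) :
  (forall xs, F xs <= 1) ->
  (forall l : {ffun 'I_m -> 'I_p}, 0 < F (codom l) -> E l) ->
  avg m F <= iid_uniform_prob R E.
Proof.
move=> F_le1 F_E; rewrite avg_finfun /iid_uniform_prob [leRHS]big_mkcond card_ord.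
have w_ge0 : 0 <= \prod_(t < m) (p%:R)^-1 :> R.
  by apply: prodr_ge0 => t _; rewrite invr_ge0.
apply: ler_sum => l _; case: asboolP => [_|nE].
  by rewrite -[leRHS]mul1r ler_wpM2r.
rewrite mulr_le0_ge0 // leNgt; apply/negP => /F_E; exact: nE.
Qed.

Theorem isometry_recovery p q (A : 'M[R[i]]_(p, q)) (mu : R) (s m : nat)
    (a : 'cV[R[i]]_q) :
  A^t* *m A = 1%:M -> (forall x j, cabs (A x j) <= mu) ->
  (0 < p)%N -> (0 < q)%N -> (1 <= s)%N -> sparse s a ->
  25 * (8 * 2048) * p%:R * mu ^+ 2 * s%:R * ln q%:R ^+ 4 <= m%:R ->
  1 - q%:R `^ (- (2 * ln q%:R ^+ 3)) <=
  iid_uniform_prob R (fun l : {ffun 'I_m -> 'I_p} =>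
    is_unique_l1_minimizer (sample_rows l A) (sample_rows l A *m a) a).
Proof.
move=> A_isom A_coh p_gt0 q_gt0 s_gt0 a_sparse m_ge.
(* For [q = 1] the logarithm vanishes and the claimed lower bound is 0. *)
have [q_le1|q_gt1] := leqP q 1.
  have -> : q%:R = 1 :> R by apply/eqP; rewrite pnatr_eq1 eqn_leq q_le1.
  rewrite ln1 expr0n mulr0 oppr0 powRr0 subrr sumr_ge0 // => l _.
  by apply: prodr_ge0 => t _; rewrite invr_ge0.
have [c c_def] : exists c : R, c = 8 * 2048 by exists (8 * 2048).
have c_ge : 48 <= c by rewrite c_def; lra.
set L := ln q%:R in m_ge *; rewrite -c_def in m_ge.
have L_ge : 1 / 2 <= L := ln_ge_half q_gt1.
have L_le := le_4cube L_ge.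
have qE : q%:R = expR L :> R by rewrite lnK // posrE ltr0n.
(* The sparsity bound s may exceed q. *)
set S := [set j : 'I_q | a j ord0 != 0]; set s' := maxn 1 #|S|.
have a_supp : supported S a by move=> j; rewrite inE negbK => /eqP.
have s'_gt0 : (0 < s')%N by rewrite leq_max.
have card_S : (#|S| <= s')%N by rewrite leq_maxr.
have s'_le : (s' <= s)%N.
  by rewrite geq_max s_gt0 (leq_trans _ a_sparse) // cardsE.
have s'_leq : (s' <= q)%N.
  by rewrite geq_max q_gt0 -[q in (_ <= q)%N]card_ord max_card.
have mu_ge0 : 0 <= mu.
  by apply: le_trans (A_coh (Ordinal p_gt0) (Ordinal q_gt0)); apply: cabs_ge0.
set K := p%:R * mu ^+ 2.
(* A column of an isometry has unit norm and [p] entries of modulus at most [mu]. *)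
have K_ge1 : 1 <= K.
  have /(congr1 (fun x => x ^+ 2)) :=
    isometry_l2norm (basis_vec (Ordinal q_gt0)) A_isom.
  rewrite l2norm_basis_vec expr1n l2norm_sqr => <-.
  rewrite /K -[p in p%:R]card_ord mulr_natl -sumr_const.
  apply: ler_sum => x _; rewrite lerXn2r ?nnegrE ?cabs_ge0 //.
  by rewrite -colE mxE.
have K_ge0 : 0 <= K by lra.
have s'_ge1 : 1 <= s'%:R :> R by rewrite ler1n.
set X := K * s'%:R; have X_ge1 : 1 <= X by rewrite mulr_ege1.
have XL_ge : 1 / 2 <= X * L by rewrite -[1 / 2]mul1r ler_pM //; lra.
have L3_ge : 1 / 8 <= L ^+ 3.
  have -> : 1 / 8 = (1 / 2) ^+ 3 :> R by field.
  by rewrite lerXn2r ?nnegrE //; lra.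
(* [k] is the number of successes wanted among [2 k] batches of length [b]. Rounding up is absorbed
   by [1 <= 8 L^3] and [1 <= 2 X L]. *)
pose k := (Num.truncn (4 * L ^+ 3)).+1.
pose b := (Num.truncn (c * X * L)).+1.
have k_gt : 4 * L ^+ 3 < k%:R by apply: truncnS_gt.
have k_le : k%:R <= 12 * L ^+ 3.
  have : (Num.truncn (4 * L ^+ 3))%:R <= 4 * L ^+ 3 by rewrite truncn_le; lra.
  have -> : k%:R = (Num.truncn (4 * L ^+ 3))%:R + 1 :> R by rewrite natr1.
  by lra.
have b_gt : c * X * L < b%:R by apply: truncnS_gt.
have b_le : b%:R <= (c + 2) * X * L.
  have : (Num.truncn (c * X * L))%:R <= c * X * L.
    by rewrite truncn_le !mulr_ge0 //; lra.
  have -> : b%:R = (Num.truncn (c * X * L))%:R + 1 :> R by rewrite natr1.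
  by lra.
(* The factor 25 arises here: [2 * 12 * (c + 2) <= 25 * c] as soon as [48 <= c]. *)
have m_gek : (k.*2 * b <= m)%N.
  rewrite -(ler_nat R) -mul2n !natrM -mulrA; apply: le_trans m_ge.
  apply: le_trans (_ : 2 * ((12 * L ^+ 3) * ((c + 2) * X * L)) <= _).
    by rewrite ler_pM2l // ler_pM.
  have -> : 2 * ((12 * L ^+ 3) * ((c + 2) * X * L)) =
      24 * (c + 2) * K * L ^+ 4 * s'%:R.
    by rewrite /X; ring.
  have -> : 25 * c * p%:R * mu ^+ 2 * s%:R * L ^+ 4 =
      25 * c * K * L ^+ 4 * s%:R.
    by rewrite /K; ring.
  have L4_ge0 : 0 <= L ^+ 4 by rewrite exprn_ge0 //; lra.
  have c2_le : 24 * (c + 2) <= 25 * c by lra.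
  have c2_ge0 : 0 <= 24 * (c + 2) by lra.
  apply: ler_pM (ler0n _ _) _ _; last by rewrite ler_nat.
    exact: mulr_ge0 (mulr_ge0 c2_ge0 K_ge0) L4_ge0.
  by rewrite ler_wpM2r // ler_wpM2r.
(* The union bound [4 q] times [q^-8] gives [4 q^-7]; moreover [16 q^-4 <= 1] because [2 <= q],
   hence [4 eps <= q^-3]. *)
pose eps := 4 * expR (- (7 * L)).
have e_le : expR (- (4 * L)) <= 16^-1.
  rewrite expRN lef_pV2 ?posrE ?expR_gt0 // expRM_natl -qE.
  have -> : 16 = 2 ^+ 4 :> R by ring.
  by rewrite lerXn2r ?nnegrE // ler_nat.
have eps_le : 4 * eps <= expR (- (3 * L)).
  have -> : 4 * eps = 16 * expR (- (4 * L)) * expR (- (3 * L)).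
    by rewrite -mulrA -expRD /eps mulrA; congr (_ * expR _); ring.
  by rewrite ler_piMl ?expR_ge0 //; lra.
have eps_itv : 0 < eps <= 1.
  rewrite mulr_gt0 ?expR_gt0 //=.
  have : expR (- (3 * L)) <= 1 by rewrite -[leRHS]expR0 ler_expR; lra.
  by lra.
have mu_gt0 : 0 < mu.
  rewrite lt0r mu_ge0 andbT; apply: contraTneq K_ge1; rewrite /K => ->.
  by rewrite expr0n mulr0 ler10.
have step_prob v : supported S v ->
    avg b (fun xs => (~~ accurate A s' b xs v)%:R : R) <= eps.
  move=> v_supp.
  have := inaccurate_prob A_isom A_coh mu_gt0 p_gt0
    (ltn0Sn _ : (0 < b)%N) s'_gt0 card_S v_supp.
  move=> /le_trans; apply.
  rewrite natrM qE /eps -mulrA -expRD ler_pM2l // ler_expR.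
  rewrite -mulrA -/X.
  (* This fixes [c]: the Bernstein denominator 2048 times the desired exponent 8. *)
  have : 8 * L <= b%:R / (2048 * X).
    by rewrite ler_pdivlMr; move: b_gt; rewrite c_def; lra.
  by lra.
pose fails v xs : bool := (k <= failures A S s' b k.*2 xs v)%N.
have fails_prob v : supported S v ->
    avg m (fun xs => (fails v xs)%:R : R) <= expR (- (3 * L)) ^+ k.
  move=> v_supp; rewrite -(subnKC m_gek).
  apply: le_trans (failures_tail p_gt0 _ _ eps_itv step_prob v_supp) _.
  by rewrite lerXn2r ?nnegrE ?expR_ge0 // mulr_ge0 //; case/andP: eps_itv => /ltW.
have r_ge1 : 1 <= Num.sqrt s'%:R :> R by rewrite -[X in X <= _]sqrtr1 ler_wsqrtr.
have cert v xs : supported S v -> l2norm v <= Num.sqrt s'%:R -> ~~ fails v xs ->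
    certified A S s' xs v.
  move=> v_supp v_le; rewrite -ltnNge => few.
  have [w [w_ann w_on w_off]] := golf_certificate A b s'_gt0 card_S k.*2 xs v_supp.
  exists w; split=> //; apply: le_trans w_on _; rewrite mulrC.
  apply: ler_wpM2l; first exact: l2norm_ge0.
  apply: le_trans (_ : 8^-1 ^+ k <= _).
    apply: ler_wiXn2l; rewrite ?invr_ge0 ?invf_le1 //; first lra.
    by rewrite -[X in (X - _)%N]addnn -addnBA ?leq_addr // (ltnW few).
  rewrite exprVn lef_pV2 ?posrE ?exprn_gt0 ?mulr_gt0 ?sqrtr_gt0 ?ltr0n //.
  (* [L <= 4 L^3 < k] gives [q = e^L <= e^k <= 4^k]. *)
  apply: sqrt_le_expn8 => //; apply: leq_trans s'_leq _.
  rewrite -(ler_nat R) natrX qE.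
  apply: le_trans (_ : expR (k%:R * (1 / 2 * 2)) <= _).
    by rewrite ler_expR; lra.
  rewrite expRM_natl lerXn2r ?nnegrE ?expR_ge0 // mulrC expRM_natl.
  have -> : 4 = 2 ^+ 2 :> R by ring.
  by rewrite lerXn2r ?nnegrE ?expR_ge0 // expR_half_le2.
(* Positive only if golfing succeeds for the sign vector and for every basis vector of [S] on the
   same samples. *)
pose F xs : R := 1 - (\sum_(j in S) (fails (basis_vec j) xs)%:R +
                      (fails (sign_vec a) xs)%:R).
apply: le_trans (iid_uniform_prob_ge (F := F) _ _).
- have -> : avg m F =
      1 - (\sum_(j in S) avg m (fun xs => (fails (basis_vec j) xs)%:R) +
           avg m (fun xs => (fails (sign_vec a) xs)%:R)).
    rewrite -avg_sum -avgD -[X in 1 - X]mul1r -mulNr -avgZ.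
    rewrite -[X in _ = X + _](avg_cst (T := 'I_p) m) ?card_ord // -avgD.
    by apply: eq_avg => xs _; rewrite mulN1r.
  rewrite lerD2l lerN2.
  apply: le_trans (_ : \sum_(j in S) expR (- (3 * L)) ^+ k +
                       expR (- (3 * L)) ^+ k <= _).
    apply: lerD; last exact/fails_prob/supported_sign_vec.
    by apply: ler_sum => j jS; exact/fails_prob/supported_basis_vec.
  rewrite sumr_const -mulrSr -[leLHS]mulr_natl.
  (* There are at most [q + 1 <= q^2] target vectors. The total [q^(2 - 3k)] is at most
     [q^(- 2 L^3)], since [2 <= 2 k] and [2 L^3 <= k]. *)
  apply: le_trans (_ : q%:R ^+ 2 * expR (- (3 * L)) ^+ k <= _).
    rewrite ler_wpM2r ?exprn_ge0 ?expR_ge0 // -natrX ler_nat.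
    have S_le : (#|S| <= q)%N.
      by rewrite -[q in (_ <= q)%N]card_ord max_card.
    apply: (@leq_trans q.+1); first by rewrite ltnS.
    by rewrite -mulnn; clear -q_gt1; nia.
  rewrite /powR pnatr_eq0 -leqn0 leqNgt q_gt0 /= -/L qE.
  rewrite -!expRM_natl -expRD ler_expR.
  have : L * (2 * L ^+ 3 + 2 - 3 * k%:R) <= 0.
    have k_ge1 : 1 <= k%:R :> R by rewrite ler1n.
    by rewrite pmulr_rle0; lra.
  by lra.
- move=> l; rewrite /F gerBl addr_ge0 ?ler0n // sumr_ge0 // => j _;
    exact: ler0n.
- move=> l; rewrite /F subr_gt0 => few.
  have no_fail v : (fails v (codom l))%:R < 1 :> R -> ~~ fails v (codom l).
    by case: (fails v _); rewrite // ltxx.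
  have sum_ge0 (P : pred 'I_q) :
      0 <= \sum_(j | P j) (fails (basis_vec j) (codom l))%:R :> R.
    by apply: sumr_ge0 => j _; apply: ler0n.
  apply: (unique_minimizer_of_certified s'_gt0 card_S a_supp) => [|j jS].
    apply: cert; first exact: supported_sign_vec.
      exact: (l2norm_sign_vec s'_gt0 card_S a_supp).
    by apply: no_fail; apply: le_lt_trans few; rewrite lerDr.
  apply: cert; [exact: supported_basis_vec|by rewrite l2norm_basis_vec|].
  apply: no_fail; apply: le_lt_trans few.
  by rewrite (bigD1 j) //= -addrA lerDl addr_ge0 // ler0n.
Qed.

End Recovery.

(** * Fourier, up-sampling and chirp operators *)

Section Isometry.
Context {R : realType}.
Implicit Types t : R.

Lemma expiD t1 t2 : expi (t1 + t2) = expi t1 * expi t2 :> R[i].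
Proof.
rewrite /expi cosD sinD; apply/eqP; rewrite eq_complex /= eqxx /=.
by apply/eqP; ring.
Qed.

Lemma expi0 : expi 0 = 1 :> R[i].
Proof. by rewrite /expi cos0 sin0. Qed.

Lemma conj_expi t : Num.conj (expi t) = expi (- t).
Proof. by rewrite /expi cosN sinN. Qed.

Lemma expi_conj_mul t : Num.conj (expi t) * expi t = 1.
Proof. by rewrite conj_expi -expiD addNr expi0. Qed.

Lemma expi_sum (I : Type) (r : seq I) (P : pred I) (F : I -> R) :
  expi (\sum_(i <- r | P i) F i) = \prod_(i <- r | P i) expi (F i).
Proof. exact: (big_morph _ expiD expi0). Qed.

Lemma expiMn t k : expi (t * k%:R) = expi t ^+ k.
Proof.
elim: k => [|k IH]; first by rewrite mulr0 expi0.
by rewrite -natr1 mulrDr mulr1 expiD IH exprSr.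
Qed.

Lemma expi_2pi : expi (2 * pi) = 1 :> R[i].
Proof. by rewrite /expi mulr_natl cos2pi sin2pi. Qed.

Lemma expi_int (k : int) : expi (2 * pi * k%:~R) = 1 :> R[i].
Proof.
have expi_nat m : expi (2 * pi * m%:R) = 1 :> R[i].
  by rewrite expiMn expi_2pi expr1n.
case: k => m; first exact: expi_nat.
rewrite NegzE mulrNz mulrN -[LHS]mulr1 -(expi_nat m.+1) -expiD.
by rewrite addNr expi0.
Qed.

(* cos t = 1 - 2 sin(t/2)^2, and the sine is positive on ]0, pi[. *)
Lemma expi_neq1 t : 0 < t < 2 * pi -> expi t != 1.
Proof.
move=> /andP[t_gt0 t_lt]; apply/negP => /eqP /(congr1 (@complex.Re R)) /= cos1.
have s_gt0 : 0 < sin (t / 2) by apply: sin_gt0_pi; apply/andP; split; lra.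
have tE : t = t / 2 + t / 2 by field.
have := cos2Dsin2 (t / 2); move: cos1; rewrite {1}tE cosD; nra.
Qed.

(** For positive [k] the angle lies strictly between 0 and 2 pi; conjugation reduces negative [k] to
    that case. *)
Lemma expi_frac_neq1 n (k : int) : k != 0 -> (`|k| < n)%N ->
  expi (2 * pi * k%:~R / n%:R) != 1 :> R[i].
Proof.
have pi_pos := pi_gt0 R.
have frac_neq1 m : (0 < m < n)%N -> expi (2 * pi * m%:R / n%:R) != 1 :> R[i].
  move=> /andP[m_gt0 m_lt]; have n_gt0 : 0 < n%:R :> R by rewrite ltr0n; lia.
  apply: expi_neq1; apply/andP; split; first by rewrite !mulr_gt0 ?ltr0n ?invr_gt0.
  rewrite ltr_pdivrMr //.
  by rewrite ltr_pM2l ?mulr_gt0 // ltr_nat.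
move=> k_neq0 k_lt; have k_itv : (0 < `|k| < n)%N by rewrite k_lt absz_gt0 k_neq0.
have := frac_neq1 _ k_itv; case: k k_neq0 k_lt k_itv => m // _ _ _.
apply: contra => /eqP /(congr1 Num.conj).
by rewrite conj_expi rmorph1 NegzE mulrNz mulrN mulNr opprK => ->.
Qed.

(** A geometric sum whose ratio is an [n]-th root of unity other than 1. *)
Lemma sum_expi_eq0 n (k : int) : k != 0 -> (`|k| < n)%N ->
  \sum_(a < n) expi (2 * pi * k%:~R / n%:R * a%:R) = 0 :> R[i].
Proof.
move=> k_neq0 k_lt; have n_gt0 : (0 < n)%N by apply: leq_ltn_trans k_lt.
have := subrX1 (expi (2 * pi * k%:~R / n%:R) : R[i]) n.
rewrite -expiMn divfK ?pnatr_eq0 -?lt0n // expi_int subrr => /esym /eqP.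
rewrite mulf_eq0 subr_eq0 (negbTE (expi_frac_neq1 k_neq0 k_lt)) /= => /eqP sum0.
by rewrite -[RHS]sum0; apply: eq_bigr => a _; rewrite expiMn.
Qed.

Lemma sum_expi_delta n (a b : nat) : (a < n)%N -> (b < n)%N ->
  \sum_(x < n) expi (2 * pi * (a%:R - b%:R) / n%:R * x%:R) =
  (a == b)%:R * n%:R :> R[i].
Proof.
move=> a_lt b_lt; have [->|a_neq] := eqVneq a b.
  rewrite mul1r subrr; under eq_bigr do rewrite mulr0 !mul0r expi0.
  by rewrite sumr_const card_ord.
rewrite mul0r -[a%:R]/(a%:Z%:~R) -[b%:R]/(b%:Z%:~R) -intrB sum_expi_eq0 //; lia.
Qed.

(** * Base-[n] digits and the Fourier basis on the grid *)

Lemma grid_coord_lt n k d : (0 < n)%N -> (grid_coord n k d < n)%N.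
Proof. by move=> n_gt0; rewrite ltn_mod. Qed.

Lemma grid_coord_inj n D k l : (k < n ^ D)%N -> (l < n ^ D)%N ->
  (forall d, (d < D)%N -> grid_coord n k d = grid_coord n l d) -> k = l.
Proof.
elim: D k l => [|D IH] k l; first by rewrite expn0; lia.
move=> k_lt l_lt eq_kl; have n_gt0 : (0 < n)%N 
  by rewrite lt0n; apply: contraTneq k_lt => ->; rewrite exp0n.
have := eq_kl 0 isT; rewrite /grid_coord expn0 !divn1 => mod_eq.
rewrite (divn_eq k n) (divn_eq l n) mod_eq; congr (_ * _ + _)%N.
apply: IH; rewrite ?ltn_divLR // -?expnSr // => d d_lt.
by have := eq_kl d.+1 d_lt; rewrite /grid_coord expnS !divnMA.
Qed.

Lemma grid_coordS n d a y : (0 < n)%N -> (a < n)%N ->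
  grid_coord n (y * n + a) d.+1 = grid_coord n y d.
Proof.
move=> n_gt0 a_lt; rewrite /grid_coord expnS divnMA divnMDl //.
by rewrite (divn_small a_lt) addn0.
Qed.

Lemma grid_coord0 n a y : (0 < n)%N -> (a < n)%N ->
  grid_coord n (y * n + a) 0 = a.
Proof.
by move=> n_gt0 a_lt; rewrite /grid_coord expn0 divn1 modnMDl modn_small.
Qed.

Lemma sum_grid (V : comPzSemiRingType) D n (f : nat -> nat -> V) : (0 < n)%N ->
  \sum_(i < n ^ D) \prod_(d < D) f d (grid_coord n i d) =
  \prod_(d < D) \sum_(a < n) f d a.
Proof.
move=> n_gt0; elim: D f => [|D IH] f.
  by rewrite expn0 big_ord_recl big_ord0 !big_ord0 addr0.
rewrite [RHS]big_ord_recl -(IH (fun d => f d.+1)) mulrC.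
rewrite -(big_mkord xpredT (fun i => \prod_(d < D.+1) f d (grid_coord n i d))).
rewrite expnSr big_nat_mul big_mkord mulr_suml; apply: eq_bigr => y _.
rewrite mulSn addnC -[(y * n)%N]add0n big_addn addKn big_mkord mulr_sumr.
apply: eq_bigr => a _; rewrite big_ord_recl addnC mulrC grid_coord0 //.
by congr (_ * _); apply: eq_bigr => d _; rewrite grid_coordS.
Qed.

(** By [sum_grid] the inner product of two columns factors over the axes into one-dimensional
    character sums; distinct indices differ in some digit, whose factor vanishes. *)
Lemma dft_isometry D n : (0 < n)%N ->
  (dft R D n (n ^ D))^t* *m dft R D n (n ^ D) = 1%:M.
Proof.
move=> n_gt0; apply/matrixP => j k; rewrite !mxE.
have N_gt0 : 0 < (n ^ D)%:R :> R by rewrite ltr0n expn_gt0 n_gt0.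
have phase_sum (x y : nat) : 2 * pi *
    (\sum_(d < D) grid_coord n x d * grid_coord n y d)%N%:R / n%:R =
    \sum_(d < D)
      2 * pi / n%:R * ((grid_coord n x d)%:R * (grid_coord n y d)%:R) :> R.
  rewrite natr_sum mulr_sumr mulr_suml; apply: eq_bigr => d _.
  by rewrite natrM; ring.
pose phase x := \prod_(d < D) expi (2 * pi *
  ((grid_coord n k d)%:R - (grid_coord n j d)%:R) / n%:R *
  (grid_coord n x d)%:R) : R[i].
transitivity (((n ^ D)%:R)^-1%:C * \sum_(x < n ^ D) phase x).
  rewrite mulr_sumr; apply: eq_bigr => x _; rewrite !mxE.
  rewrite conjM conj_expi conj_real mulrACA -expiD.
  rewrite -rmorphM /= -invfM -expr2 sqr_sqrtr ?ltW //; congr (_ * _).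
  rewrite /phase -expi_sum; congr expi.
  rewrite !phase_sum -sumrN -big_split; apply: eq_bigr => d _ /=; ring.
rewrite (sum_grid D (fun d a => expi (2 * pi *
  ((grid_coord n k d)%:R - (grid_coord n j d)%:R) / n%:R * a%:R))) //.
under eq_bigr do rewrite sum_expi_delta ?grid_coord_lt //.
have [->|jk] := eqVneq j k.
  under eq_bigr do rewrite eqxx mul1r.
  rewrite prodr_const card_ord -natrX -(rmorph_nat (real_complex R)) -rmorphM /=.
  by rewrite mulVf ?rmorph1 ?gt_eqF.
suff [d d_neq] : exists d : 'I_D, grid_coord n k d != grid_coord n j d.
  by rewrite (bigD1 d) //= (negbTE d_neq) !mul0r mulr0.
apply/existsP; apply: contraNT jk; rewrite negb_exists => /forallP eq_jk.
apply/eqP/val_inj/(@grid_coord_inj n D); rewrite ?ltn_ord // => d d_lt.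
by have := eq_jk (Ordinal d_lt); rewrite negbK => /eqP.
Qed.

(** * Zero padding and up-sampling *)

Lemma signed_freq_inj n f g : (f < n)%N -> (g < n)%N ->
  signed_freq n f = signed_freq n g -> f = g.
Proof. by rewrite /signed_freq; do 2![case: ifP]; lia. Qed.

Lemma signed_freq_widen n nw f : (f < n <= nw)%N ->
  exists2 g, (g < nw)%N & signed_freq nw g = signed_freq n f.
Proof.
(* A negative frequency [f - n] is stored at index [nw + (f - n)] of the larger grid. *)
move=> f_lt; exists (if (f.*2 < n)%N then f else nw + f - n)%N.
  by case: ifP; lia.
by rewrite /signed_freq; do 2![case: ifP]; lia.
Qed.

Lemma grid_coord_surj n D (f : nat -> nat) : (0 < n)%N ->
  (forall d, (d < D)%N -> (f d < n)%N) ->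
  exists2 k, (k < n ^ D)%N & forall d, (d < D)%N -> grid_coord n k d = f d.
Proof.
move=> n_gt0; elim: D f => [|D IH] f f_lt; first by exists 0%N.
have [|k k_lt kE] := IH (fun d => f d.+1); first by move=> d d_lt; apply: f_lt.
have f0_lt := f_lt 0 isT; exists (k * n + f 0)%N => [|[|d] d_lt].
- apply: (@leq_trans (k.+1 * n)); first by rewrite mulSn addnC ltn_add2r.
  by rewrite expnSr leq_mul2r k_lt orbT.
- exact: grid_coord0.
- by rewrite grid_coordS // kE.
Qed.

(** Each column holds a single 1, in the row of its frequency, and distinct columns use distinct
    rows. *)
Lemma zero_padding_isometry D n nw : (0 < n <= nw)%N ->
  let P := zero_padding R D n nw (n ^ D) (nw ^ D) in P^t* *m P = 1%:M.
Proof.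
move=> /andP[n_gt0 n_le] P; have nw_gt0 := leq_trans n_gt0 n_le.
apply/matrixP => j k; rewrite !mxE.
pose same x y := [forall d : 'I_D,
  signed_freq nw (grid_coord nw x d) == signed_freq n (grid_coord n y d)].
transitivity (\sum_(x < nw ^ D) (same x j && same x k)%:R : R[i]).
  apply: eq_bigr => x _; rewrite !mxE -/(same x j) -/(same x k) conjC_nat.
  by case: (same x j); rewrite ?mul1r ?mul0r.
have [<-|jk] := eqVneq j k; last first.
  rewrite big1 // => x _; case: andP => // -[/forallP xj /forallP xk].
  case/eqP: jk; apply/val_inj/(@grid_coord_inj n D); rewrite ?ltn_ord // => d d_lt.
  apply: (@signed_freq_inj n); rewrite ?grid_coord_lt //.
  by rewrite -(eqP (xj (Ordinal d_lt))) (eqP (xk (Ordinal d_lt))).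
(* The digits of that row, chosen axis by axis; [signed_freq_widen] excludes the default value 0. *)
pose g d := if [pick y : 'I_nw | signed_freq nw y ==
  signed_freq n (grid_coord n j d)] is Some y then nat_of_ord y else 0%N.
have g_spec d : (g d < nw)%N /\
    signed_freq nw (g d) = signed_freq n (grid_coord n j d).
  rewrite /g; case: pickP => [y /eqP -> //|none]; exfalso.
  have [|y y_lt /eqP yE] := @signed_freq_widen n nw (grid_coord n j d).
    by rewrite grid_coord_lt.
  by have := none (Ordinal y_lt); rewrite yE.
have [x x_lt xE] := grid_coord_surj nw_gt0 (fun d _ => (g_spec d).1) (D := D).
have same_x : same x j.
  by apply/forallP => d; rewrite xE //; apply/eqP; case: (g_spec d).
rewrite (bigD1 (Ordinal x_lt)) //= same_x big1 ?addr0 // => y /eqP neq_yx.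
case: andP => // -[/forallP yj _]; case: neq_yx.
apply/val_inj/(@grid_coord_inj nw D); rewrite ?ltn_ord // => d d_lt.
apply: (@signed_freq_inj nw); rewrite ?grid_coord_lt //.
by rewrite (eqP (yj (Ordinal d_lt))) xE // (g_spec d).2.
Qed.

Lemma upsampling_isometry D n nw : (0 < n <= nw)%N ->
  let U := upsampling R D n nw (n ^ D) (nw ^ D) in U^t* *m U = 1%:M.
Proof.
move=> n_itv U; have /andP[n_gt0 n_le] := n_itv.
have dft_V : dft R D n (n ^ D) *m (dft R D n (n ^ D))^t* = 1%:M.
  exact/mulmx1C/dft_isometry.
rewrite /U /upsampling !trmx_mul !map_mxM -!mulmxA (mulmxA _ (dft R D nw _)).
rewrite dft_isometry ?(leq_trans n_gt0) // mul1mx.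
rewrite (mulmxA _ (zero_padding _ _ _ _ _ _)).
by rewrite zero_padding_isometry // mul1mx trmxCK.
Qed.

Lemma chirp_mx_isometry D nw Nw (w L : R) (x0 : 'rV[R]_D) :
  let C : 'M[R[i]]_Nw := chirp_mx nw Nw w L x0 in C^t* *m C = 1%:M.
Proof.
move=> C; rewrite /C /chirp_mx tr_diag_mx map_diag_mx mulmx_diag.
rewrite -diag_const_mx; congr diag_mx; apply/rowP => k.
by rewrite !mxE expi_conj_mul.
Qed.

End Isometry.

(** * Coherence as an entrywise bound, and products of isometries *)

Section Coherence.
Context {R : realType}.

Lemma le_coherence p q (F : 'M[R[i]]_p) (M : 'M[R[i]]_(p, q)) (Psi : 'M[R[i]]_q)
    (x : 'I_p) (j : 'I_q) :
  cabs ((F^t* *m M *m Psi) x j) <= coherence F M Psi.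
Proof.
have -> : (F^t* *m M *m Psi) x j = inner (col x F) (M *m col j Psi).
  rewrite innerE -mulmxA mxE; apply: eq_bigr => k _; rewrite !mxE; congr (_ * _).
  by apply: eq_bigr => l _; rewrite mxE.
rewrite /coherence; apply: le_trans (le_bigmax _ _ x).
exact: (le_bigmax _ (fun j => cabs (inner _ (M *m col j Psi))) j).
Qed.

Lemma mulmx_isometry m p q (A : 'M[R[i]]_(m, p)) (B : 'M[R[i]]_(p, q)) :
  A^t* *m A = 1%:M -> B^t* *m B = 1%:M -> (A *m B)^t* *m (A *m B) = 1%:M.
Proof.
move=> A_isom B_isom; rewrite trmx_mul map_mxM -mulmxA (mulmxA _ A).
by rewrite A_isom mul1mx.
Qed.

End Coherence.

Theorem theorem4 (R : realType) :
  exists C0 gamma : R, 0 < C0 /\ 1 < gamma /\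
  forall (D n nw N Nw : nat) (w L : R) (x0 : 'rV[R]_D) (Psi : 'M[R[i]]_N),
    (D = 1 \/ D = 2)%N ->
    (0 < n)%N ->
    N = (n ^ D)%N ->
    Nw = (nw ^ D)%N ->
    0 < L ->
    Nw%:R = (1 + `|discrete_chirp_rate w L N|) * N%:R ->
    Psi \is unitarymx ->
    let U : 'M[R[i]]_(Nw, N) := upsampling R D n nw N Nw in
    let C : 'M[R[i]]_Nw := chirp_mx nw Nw w L x0 in
    let F : 'M[R[i]]_Nw := dft R D nw Nw in
    let A : 'M[R[i]]_(Nw, N) := F^t* *m C *m U *m Psi in
    let mu : R := coherence F (C *m U) Psi in
    forall (s m : nat) (alpha : 'cV[R[i]]_N),
      (1 <= s)%N ->
      sparse s alpha ->
      C0 * Nw%:R * mu ^+ 2 * s%:R * (ln N%:R) ^+ 4 <= m%:R ->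
      1 - N%:R `^ (- (gamma * (ln N%:R) ^+ 3)) <=
        iid_uniform_prob R
          (fun l : {ffun 'I_m -> 'I_Nw} =>
             is_unique_l1_minimizer (sample_rows l A)
               (sample_rows l A *m alpha) alpha).
Proof.
exists (25 * (8 * 2048)), 2; split; [by lra|split; [by lra|]].
move=> D n nw N Nw w L x0 Psi D12 n_gt0 NE NwE _ Nw_size Psi_unitary.
move=> U C F A mu s m alpha.
have D_gt0 : (0 < D)%N by case: D12 => ->.
have N_gt0 : (0 < N)%N by rewrite NE expn_gt0 n_gt0.
(* The factor [1 + |w|] is at least 1; taking [D]-th roots gives [n <= nw], as zero padding
   requires. *)
have N_le : (N <= Nw)%N.
  by rewrite -(ler_nat R) Nw_size ler_peMl // lerDl.
have n_le : (n <= nw)%N by rewrite -(leq_exp2r _ _ D_gt0) -NE -NwE.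
apply: isometry_recovery => //; last exact: leq_trans N_le.
  subst N Nw; rewrite /A.
  have F_isom : F^t* *m F = 1%:M by rewrite dft_isometry // (leq_trans n_gt0).
  (* Peels off [Psi], then [U], then [C]; what remains is the adjoint of the unitary [F]. *)
  apply: mulmx_isometry; last exact/mulmx1C/unitarymxP.
  apply: mulmx_isometry; last by rewrite upsampling_isometry // n_gt0.
  apply: mulmx_isometry; last exact: chirp_mx_isometry.
  by rewrite trmxCK; apply: mulmx1C.
by move=> x j; rewrite /A -(mulmxA _ C); apply: le_coherence.
Qed.
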